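(* There exists a constant $c>0$ such that for every finite set $X$ with $|X|=n$ and every family $\mathcal R$ of subsets of $X$ with $|\mathcal R|> c n^{3-1/4}$, there exist three sets $R_1,R_2,R_3\in\mathcal R$ whose Venn diagram has at least $7$ of its $8$ regions nonempty; that is, for at least $7$ of the $8$ subsets $S\subseteq\{1,2,3\}$ there is an element $x\in X$ with $x\in R_i \iff i\in S$ for all $i\in\{1,2,3\}$.
   Formalization: The set X is assumed nonempty (n ≥ 1); for X empty and the family consisting of the empty set alone, the claim as stated is false for every c. *)

(* Defs.v *)
From HB Require Import structures.
From mathcomp Require Import all_boot all_order all_algebra.
From mathcomp Require Import all_classical all_reals all_analysis.

Set Implicit Arguments.
Unset Strict Implicit.
Unset Printing Implicit Defensive.

(* The index set {1,2,3} is encoded as 'I_3 = {0,1,2}; a region of the Venn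
   diagram of three sets is identified with a subset of 'I_3. *)
Definition nonempty_regions (X : finType) (A : 'I_3 -> {set X}) :
    {set {set 'I_3}} :=
  [set S : {set 'I_3} | [exists x : X, [forall i, (x \in A i) == (i \in S)]]].

(* Main.v *)
Require Import Defs.
From HB Require Import structures.
From mathcomp Require Import all_boot all_order all_algebra.
From mathcomp Require Import ring lra.

(* Idea. For [J] inside [Y] let [cubes F Y J] be the set of base points [W] of
   full cubes {W u S : S inside J} in the trace of [F] on [Y].  Deleting a
   point k gives |cubes Y J| <= |cubes Y (J u k)| + |cubes (Y - k) J|; averaged
   over all Y of a given size, this reads "the increment in |Y| of the average
   for |J| = d is at most the average for |J| = d + 1".  Hence it suffices to
   bound the number of pairs (J, W) with |J| = 3 by O(|Y|^(11/4)).
   Each triple J has at most 8 base points: among 9 sets some three already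
   have 4 regions outside J, and the 3 free points of J provide 3 more.
   The triples carrying a cube contain no K_{2,2,2}: three of its edges
   a1b1c1, a1b2c2, a2b1c2 and any seventh point would yield 7 regions.  Erdos'
   double Cauchy-Schwarz argument then bounds the number of such triples. *)

Set Implicit Arguments.
Unset Strict Implicit.
Unset Printing Implicit Defensive.

(** * Cauchy-Schwarz inequalities for finite sums of natural numbers *)

Lemma sum_sqr_le (I : finType) (A : {set I}) (f : I -> nat) :
  (\sum_(i in A) f i) ^ 2 <= #|A| * \sum_(i in A) f i ^ 2.
Proof.
rewrite -(leq_pmul2l (isT : 0 < 2)) -mulnn big_distrlr /= big_distrr /=.
under eq_bigr do rewrite big_distrr /=.
apply: (@leq_trans (\sum_(i in A) \sum_(j in A) (f i ^ 2 + f j ^ 2))).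
  by apply: leq_sum => i _; apply: leq_sum => j _; exact: nat_Cauchy.
under eq_bigr do rewrite big_split /= sum_nat_const.
by rewrite big_split /= -big_distrr /= sum_nat_const addnn mul2n.
Qed.

(** Cauchy-Schwarz over [j], then each squared column sum is expanded. When [f] is the incidence of
    a bipartite graph, the right side counts common neighbours of ordered pairs in [A]. *)
Lemma codegree_ge (I J : finType) (A : {set I}) (B : {set J}) (f : I -> J -> nat) :
  (\sum_(i in A) \sum_(j in B) f i j) ^ 2
    <= #|B| * \sum_(i1 in A) \sum_(i2 in A) \sum_(j in B) f i1 j * f i2 j.
Proof.
rewrite exchange_big /=; apply: leq_trans (sum_sqr_le _ _) _.
rewrite leq_mul2l; apply/orP; right; rewrite eq_leq //.
under eq_bigr do rewrite -mulnn big_distrlr /=.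
by rewrite exchange_big /=; apply: eq_bigr => i1 _; rewrite exchange_big.
Qed.

Lemma sum_setX (I J : finType) (A : {set I}) (B : {set J}) (f : I * J -> nat) :
  \sum_(p in setX A B) f p = \sum_(i in A) \sum_(j in B) f (i, j).
Proof.
by rewrite pair_big; apply: eq_big => [[i j]|[i j] _] //; rewrite !inE.
Qed.

(** * Erdos' bound for ternary relations without K_{2,2,2} *)

Section TripartiteTuran.
Variables (T : finType) (Y : {set T}) (h : T -> T -> T -> bool).

Let m := #|Y|.
Let S := \sum_(a in Y) \sum_(b in Y) \sum_(c in Y) h a b c.
Let h4 a1 a2 b1 b2 c := (h a1 b1 c && h a2 b1 c) && (h a1 b2 c && h a2 b2 c).
Let N := \sum_(b1 in Y) \sum_(b2 in Y) \sum_(a1 in Y) \sum_(a2 in Y)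
  \sum_(c in Y) h4 a1 a2 b1 b2 c.

(** [codegree_ge] is applied twice: doubling [a] against the pairs (b, c) gives S^2 <= m^2 Q, and
    doubling [b] against the triples (a1, a2, c) gives Q^2 <= m^3 N. *)
Lemma edges4_le_squares : S ^ 4 <= m ^ 7 * N.
Proof.
pose Q := \sum_(a1 in Y) \sum_(a2 in Y) \sum_(b in Y) \sum_(c in Y)
  (h a1 b c && h a2 b c).
have SQ : S ^ 2 <= m ^ 2 * Q.
  have := codegree_ge Y (setX Y Y) (fun a p => h a p.1 p.2).
  rewrite cardsX mulnn; under eq_bigr do rewrite sum_setX.
  under [in X in _ <= X -> _]eq_bigr do under eq_bigr do rewrite sum_setX /=.
  by under [in X in _ <= X -> _]eq_bigr do
    under eq_bigr do under eq_bigr do under eq_bigr do rewrite mulnb.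
have QE : Q = \sum_(b in Y) \sum_(a1 in Y) \sum_(a2 in Y) \sum_(c in Y)
    (h a1 b c && h a2 b c).
  by rewrite /Q; under eq_bigr do rewrite exchange_big /=; rewrite exchange_big.
have QN : Q ^ 2 <= m ^ 3 * N.
  have := codegree_ge Y (setX Y (setX Y Y))
    (fun b p => h p.1 b p.2.2 && h p.2.1 b p.2.2).
  rewrite !cardsX; under eq_bigr do rewrite sum_setX.
  under eq_bigr do under eq_bigr do rewrite sum_setX /=.
  under [in X in _ <= X -> _]eq_bigr do under eq_bigr do rewrite sum_setX.
  under [in X in _ <= X -> _]eq_bigr do under eq_bigr do
    under eq_bigr do rewrite sum_setX /=.
  under [in X in _ <= X -> _]eq_bigr do under eq_bigr do
    under eq_bigr do under eq_bigr do under eq_bigr do rewrite mulnb.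
  by rewrite -QE.
rewrite -[4]/(2 * 2) expnM -[7]/(2 * 2 + 3) expnD -mulnA.
apply: leq_trans (_ : (m ^ 2 * Q) ^ 2 <= _); first by rewrite leq_exp2r.
by rewrite expnMn -expnM leq_mul2l QN orbT.
Qed.

Hypothesis K222_free : forall a1 a2 b1 b2 c1 c2,
  a1 \in Y -> a2 \in Y -> b1 \in Y -> b2 \in Y -> c1 \in Y -> c2 \in Y ->
  a1 != a2 -> b1 != b2 -> c1 != c2 ->
  h4 a1 a2 b1 b2 c1 -> h4 a1 a2 b1 b2 c2 -> False.

Lemma squares_le : N <= 3 * m ^ 4.
Proof.
(* For a1 != a2 and b1 != b2 at most one [c] is possible, since two would complete a K_{2,2,2};
   degenerate pairs get the trivial bound [m]. Each of the three terms of [u] sums to m^4. *)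
pose u (a1 a2 b1 b2 : T) : nat := (b1 == b2) * m + (a1 == a2) * m + 1.
have le_u a1 a2 b1 b2 : a1 \in Y -> a2 \in Y -> b1 \in Y -> b2 \in Y ->
    \sum_(c in Y) h4 a1 a2 b1 b2 c <= u a1 a2 b1 b2.
  move=> Ya1 Ya2 Yb1 Yb2; rewrite /u.
  rewrite (_ : \sum_(c in Y) _ = #|[set c in Y | h4 a1 a2 b1 b2 c]|); last first.
    by rewrite -sum1dep_card big_mkcondr /=; apply: eq_bigr => c _; case: ifP.
  have le_m : #|[set c in Y | h4 a1 a2 b1 b2 c]| <= m.
    by apply: subset_leq_card; apply/subsetP => c; rewrite inE => /andP[].
  have [_|nb] := eqVneq b1 b2.
    by rewrite mul1n -addnA (leq_trans le_m) ?leq_addr.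
  have [_|na] := eqVneq a1 a2.
    by rewrite mul0n mul1n add0n (leq_trans le_m) ?leq_addr.
  rewrite leqNgt !mul0n !add0n; apply/card_gt1P => -[c1 [c2 [+ + nc]]].
  by rewrite !inE => /andP[Yc1 h1] /andP[Yc2 h2]; exact: K222_free h1 h2.
apply: (@leq_trans (\sum_(b1 in Y) \sum_(b2 in Y) \sum_(a1 in Y) \sum_(a2 in Y)
  u a1 a2 b1 b2)).
  by do 4![apply: leq_sum => ? ?]; exact: le_u.
have diag (x : T) : x \in Y -> \sum_(y in Y) (x == y : nat) = 1.
  move=> Yx; rewrite (bigD1 x) //= eqxx big1 ?addn0 // => y /andP[_].
  by rewrite eq_sym => /negbTE->.
have sum_diag (x : T) k : x \in Y -> \sum_(y in Y) (x == y) * k = k.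
  by move=> Yx; rewrite -big_distrl /= diag // mul1n.
rewrite eq_leq //; transitivity (\sum_(b1 in Y) 3 * m ^ 3); last first.
  by rewrite sum_nat_const -/m mulnCA -expnS.
apply: eq_bigr => b1 Yb1.
transitivity (\sum_(b2 in Y) ((b1 == b2) * m ^ 3 + 2 * m ^ 2)); last first.
  by rewrite big_split /= sum_diag // sum_nat_const -/m mulnCA -expnS -mulSn.
apply: eq_bigr => b2 _.
transitivity (\sum_(a1 in Y) ((b1 == b2) * m ^ 2 + 2 * m)); last first.
  by rewrite sum_nat_const -/m mulnDr mulnCA -expnS mulnCA mulnn.
apply: eq_bigr => a1 Ya1.
rewrite !big_split /= sum_diag // !sum_nat_const -/m muln1 mulnCA mulnn.
by rewrite -addnA addnn mul2n.
Qed.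

Lemma K222_free_bound : S ^ 4 <= 3 * m ^ 11.
Proof.
apply: leq_trans edges4_le_squares _.
apply: leq_trans (_ : m ^ 7 * (3 * m ^ 4) <= _).
  by rewrite leq_mul2l squares_le orbT.
by rewrite mulnCA -expnD.
Qed.
End TripartiteTuran.

(** * Finite search for seven distinct types *)

(** Boolean quantifiers are written with [if] because [vm_compute] evaluates function arguments
    eagerly: the second branch is explored only when the first does not decide. *)
Definition ballb (P : bool -> bool) := if P true then P false else false.
Definition bexb (P : bool -> bool) := if P true then true else P false.

Lemma ballbP (P : bool -> bool) : ballb P -> forall b, P b.
Proof. by rewrite /ballb; case: ifP => // Pt Pf []. Qed.

Lemma bexbP (P : bool -> bool) : bexb P -> exists b, P b.
Proof. by rewrite /bexb; case: ifP => Pb Pf; [exists true | exists false]. Qed.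

(* The entries are the types of a1, b1, c2, p, a2, b2, c1 in three sets chosen
   in the cubes over a1b1c1, a1b2c2, a2b1c2: the bits x, y, z can be chosen
   freely, the bits p and s are those of the base points of the cubes.  In the
   computation the points with one free bit come first, to prune the search. *)
Lemma distinct_types (p1 p2 p3 s1 s2 s3 s4 s5 s6 s7 s8 s9 : bool) :
  exists x1 x2 x3 y1 y2 y3 z1 z2 z3 : bool,
    uniq [:: (x1, x2, s1); (y1, s4, y3); (s9, z2, z3); (p1, p2, p3); (s2, s3, x3);
             (s5, y2, s6); (z1, s7, s8)].
Proof.
have: ballb (fun p1 => ballb (fun p2 => ballb (fun p3 => ballb (fun s1 =>
  ballb (fun s2 => ballb (fun s3 => ballb (fun s4 => ballb (fun s5 =>
  ballb (fun s6 => ballb (fun s7 => ballb (fun s8 => ballb (fun s9 =>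
  bexb (fun x3 => bexb (fun y2 => bexb (fun z1 =>
  let l := [:: (p1, p2, p3); (s2, s3, x3); (s5, y2, s6); (z1, s7, s8)] in
  if uniq l then bexb (fun x1 => bexb (fun x2 =>
  if (x1, x2, s1) \notin l then bexb (fun y1 => bexb (fun y3 =>
  bexb (fun z2 => bexb (fun z3 =>
    uniq [:: (x1, x2, s1), (y1, s4, y3), (s9, z2, z3) & l]))))
  else false)) else false))))))))))))))).
  by vm_compute.
move=> /ballbP/(_ p1)/ballbP/(_ p2)/ballbP/(_ p3)/ballbP/(_ s1)/ballbP/(_ s2).
move=> /ballbP/(_ s3)/ballbP/(_ s4)/ballbP/(_ s5)/ballbP/(_ s6)/ballbP/(_ s7).
move=> /ballbP/(_ s8)/ballbP/(_ s9).
case/bexbP => x3 /bexbP[y2 /bexbP[z1 /=]]; case: ifP => // _.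
case/bexbP => x1 /bexbP[x2]; case: ifP => // _.
case/bexbP => y1 /bexbP[y3 /bexbP[z2 /bexbP[z3 H]]].
by exists x1, x2, x3, y1, y2, y3, z1, z2, z3.
Qed.

(** * Four regions from nine sets *)

Definition vtype (X : finType) (A B C : {set X}) (v : X) : bool * bool * bool :=
  (v \in A, v \in B, v \in C).

(** If no [A] in [G] splits a fibre of [phi], every [A] is a union of fibres within [Y] and is
    recovered from [phi @: A], so [G] injects into the subsets of [phi @: Y]. *)
Lemma refine_image (X T : finType) (Y : {set X}) (phi : X -> T)
    (G : {set {set X}}) :
  (forall A, A \in G -> A \subset Y) -> 2 ^ #|phi @: Y| < #|G| ->
  exists2 A, A \in G & #|phi @: Y| < #|(fun v => (phi v, v \in A)) @: Y|.
Proof.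
move=> sGY ltG; apply/exists_inP; apply: contraLR ltG => /exists_inPn le_phi.
rewrite -leqNgt -card_powerset.
(* Without growth the projection [fst] is injective on the refined image, so membership in [A]
   depends on [phi] alone. *)
have measG A v w : A \in G -> v \in Y -> w \in Y -> phi v = phi w ->
    (v \in A) = (w \in A).
  move=> GA Yv Yw e; have := le_phi A GA; rewrite -leqNgt.
  set P := _ @: Y => leP.
  have defP : fst @: P = phi @: Y by rewrite -imset_comp.
  have inj : {in P &, injective fst}.
    by apply/imset_injP; rewrite eqn_leq leq_imset_card defP.
  have Pv : (phi v, v \in A) \in P by apply: imset_f.
  have Pw : (phi w, w \in A) \in P by apply: imset_f.
  by case: (inj _ _ Pv Pw e).
have inj : {in G &, injective (fun A : {set X} => phi @: A)}.
  have sub A B : A \in G -> B \in G -> phi @: A = phi @: B -> A \subset B.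
    move=> GA GB eAB; apply/subsetP => v Av.
    have: phi v \in phi @: B by rewrite -eAB imset_f.
    case/imsetP => w Bw e.
    have Yv : v \in Y := subsetP (sGY _ GA) _ Av.
    by rewrite (measG B v w) // (subsetP (sGY _ GB)).
  by move=> A B GA GB eAB; apply/eqP; rewrite eqEsubset !sub.
rewrite -(card_in_imset inj); apply: subset_leq_card; apply/subsetP => _ /imsetP[A GA ->].
by rewrite inE imsetS ?sGY.
Qed.

(** Starting from the constant map, each chosen set adds a class as long as there are at most 3 of
    them, because 2^3 < #|G|; three sets thus give 4 classes. *)
Lemma four_regions (X : finType) (Y : {set X}) (G : {set {set X}}) :
  (forall A, A \in G -> A \subset Y) -> 8 < #|G| ->
  exists A B C, [/\ A \in G, B \in G, C \in G & 4 <= #|vtype A B C @: Y|].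
Proof.
move=> sGY gt8.
have step (T : finType) (phi : X -> T) n : n < 4 -> n <= #|phi @: Y| ->
    exists2 A, A \in G & n < #|(fun v => (phi v, v \in A)) @: Y|.
  move=> lt4 len; have [le3|gt3] := leqP #|phi @: Y| 3.
    have [|A GA ltA] := @refine_image _ _ Y phi G sGY.
      by apply: leq_ltn_trans gt8; rewrite -[8]/(2 ^ 3) leq_exp2l.
    by exists A => //; exact: leq_ltn_trans ltA.
  have /card_gt0P[A GA] : 0 < #|G| by exact: leq_ltn_trans gt8.
  exists A => //; apply: leq_trans lt4 _; apply: leq_trans gt3 _.
  rewrite -[X in #|X @: Y|](_ : fst \o (fun v => (phi v, v \in A)) = phi) //.
  by rewrite imset_comp leq_imset_card.
have Y0 : 0 < #|(fun _ : X => tt) @: Y|.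
  rewrite card_gt0 imset_eq0; apply: contraTneq gt8 => Y0.
  rewrite -leqNgt (@leq_trans 1) // -[1](cards1 (@set0 X)).
  by apply: subset_leq_card; apply/subsetP => A /sGY; rewrite Y0 subset0 inE.
have [A GA leA] := step _ _ 1 isT Y0.
have [B GB leB] := step _ _ 2 isT leA.
have [C GC leC] := step _ _ 3 isT leB.
exists A, B, C; split=> //; apply: leq_trans leC _.
rewrite -[X in #|X @: Y|]/((fun t => (tt, t.1.1, t.1.2, t.2)) \o vtype A B C).
by rewrite imset_comp leq_imset_card.
Qed.

(** * Cubes in traces and the regions they force *)

Section Cubes.
Variables (X : finType) (F : {set {set X}}).
Implicit Types (Y J W A B C : {set X}).

Definition trace Y : {set {set X}} := [set A :&: Y | A in F].

Definition cubes Y J : {set {set X}} :=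
  [set W : {set X} | (W \subset Y :\: J) &&
     [forall S : {set X}, (S \subset J) ==> (W :|: S \in trace Y)]].

Lemma cubesP Y J W :
  reflect (W \subset Y :\: J /\ forall S : {set X}, S \subset J -> W :|: S \in trace Y)
    (W \in cubes Y J).
Proof.
rewrite inE; apply: (iffP andP) => -[sW H]; split=> //.
  by move=> S; move/forallP/(_ S)/implyP: H.
by apply/forallP => S; apply/implyP; exact: H.
Qed.

Lemma trace_setD1 Y k A : A \in trace Y -> A :\ k \in trace (Y :\ k).
Proof. by case/imsetP => B FB ->; apply/imsetP; exists B; rewrite // setIDA. Qed.

(** Base points are split by whether they contain [k], and [k] is deleted from those that do. The
    two classes have total size union plus intersection: the union consists of base points in
    [Y :\ k], and a common element is the base point of a cube that also has direction [k]. *)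
Lemma cubes_rec Y J k : k \in Y -> k \notin J ->
  #|cubes Y J| <= #|cubes Y (k |: J)| + #|cubes (Y :\ k) J|.
Proof.
move=> Yk Jk.
pose F0 := [set W in cubes Y J | k \notin W].
pose F1 := [set W in cubes Y J | k \in W].
pose F1' := [set W :\ k | W in F1].
have cardF : #|cubes Y J| = #|F0| + #|F1'|.
  rewrite card_in_imset => [|W1 W2].
    rewrite addnC -(cardsID [set W : {set X} | k \in W] (cubes Y J)).
    by congr (_ + _); apply: eq_card => W; rewrite !inE // andbC.
  by rewrite !inE => /andP[_ k1] /andP[_ k2] /(congr1 (setU [set k])); rewrite !setD1K.
rewrite cardF -(cardsUI F0) addnC leq_add //; apply: subset_leq_card; apply/subsetP => W.
  case/setIP; rewrite [_ \in F0]inE => /andP[/cubesP[sW tW] kW].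
  case/imsetP => W1; rewrite [_ \in F1]inE => /andP[/cubesP[sW1 tW1] kW1] defW.
  apply/cubesP; split.
    by rewrite setUC -setDDl subsetD1 sW.
  move=> S sS; have [kS|kS] := boolP (k \in S).
    rewrite -(setD1K kS) setUA [W :|: _]setUC defW setD1K //; apply: tW1.
    by rewrite subDset.
  apply: tW; apply/subsetP => v Sv; have := subsetP sS v Sv; rewrite !inE.
  by case: eqP kS => // <-; rewrite Sv.
have Jk' (S : {set X}) : S \subset J -> S :\ k = S.
  move=> sS; apply/setDidPl; rewrite disjoint_sym disjoints1.
  by apply: contra Jk => /(subsetP sS).
have mem W0 : W0 \in cubes Y J -> W0 :\ k \in cubes (Y :\ k) J.
  case/cubesP => sW tW; apply/cubesP; split.
    apply/subsetP => v; rewrite !inE => /andP[-> /(subsetP sW)].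
    by rewrite !inE.
  by move=> S sS; rewrite -(Jk' S) // -setDUl; apply/trace_setD1/tW.
case/setUP => [|/imsetP[W1]]; rewrite [_ \in finset _]inE => /andP[cW kW].
  by have := mem _ cW; rewrite (_ : W :\ k = W) //; apply/setDidPl; rewrite disjoint_sym disjoints1.
by move=> ->; exact: mem.
Qed.

(** Memberships of the points of [J] can be prescribed at will, while outside [J] they are those of
    the base point. *)
Lemma cube_vertex Y J W (f : X -> bool) : W \in cubes Y J ->
  exists2 A, A \in trace Y & forall v, (v \in A) = if v \in J then f v else v \in W.
Proof.
case/cubesP => sW tW; exists (W :|: [set v in J | f v]) => [|v].
  by apply: tW; apply/subsetP => v; rewrite inE => /andP[].
rewrite !inE; case: ifP => Jv /=; last by rewrite orbF.
by case: (boolP (v \in W)) => // /(subsetP sW); rewrite !inE Jv.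
Qed.

Lemma card_types_trace Y A B C :
  A \in trace Y -> B \in trace Y -> C \in trace Y ->
  exists A' B' C', [/\ A' \in F, B' \in F, C' \in F &
    #|vtype A B C @: Y| <= #|vtype A' B' C' @: setT|].
Proof.
move=> /imsetP[A' FA ->] /imsetP[B' FB ->] /imsetP[C' FC ->].
exists A', B', C'; split=> //; apply: subset_leq_card; apply/subsetP => t.
case/imsetP => v Yv ->; apply/imsetP; exists v => //.
by rewrite /vtype !inE Yv !andbT.
Qed.

Hypothesis le6 : forall A B C, A \in F -> B \in F -> C \in F ->
  #|vtype A B C @: setT| <= 6.

(** Used for contradictions: seven distinct types realized in [Y] by three traces lift to members of
    [F] and refute [le6]. *)
Lemma types_le6 Y A B C (s : seq (bool * bool * bool)) :
  A \in trace Y -> B \in trace Y -> C \in trace Y ->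
  uniq s -> {subset s <= vtype A B C @: Y} -> size s <= 6.
Proof.
move=> tA tB tC us sub.
have [A' [B' [C' [FA FB FC leY]]]] := card_types_trace tA tB tC.
apply: leq_trans (le6 FA FB FC); apply: leq_trans leY.
by apply/card_geqP; exists s.
Qed.

Lemma card_cubes3_le8 Y x y z : x \in Y -> y \in Y -> z \in Y ->
  x != y -> x != z -> y != z -> #|cubes Y [set x; y; z]| <= 8.
Proof.
move=> Yx Yy Yz xy xz yz; rewrite leqNgt; apply/negP => gt8.
set J := [set x; y; z] in gt8.
have [|A [B [C [cA cB cC]]]] := @four_regions _ (Y :\: J) (cubes Y J) _ gt8.
  by move=> W /cubesP[].
case/card_geqP => s [us s4 subs].
(* The four types in [s] leave four of the eight triples of bits; three of these are assigned to x,
   y and z through the free directions. *)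
have : 3 <= #|[predC s]|.
  by rewrite -(leq_add2l #|s|) cardC (card_uniqP us) s4 !card_prod !card_bool.
case/card_geqP => s' []; case: s' => [|t1 [|t2 [|t3 []]]] // ut _ subt.
pose f (g : bool * bool * bool -> bool) v := if v == x then g t1 else
  if v == y then g t2 else g t3.
have [A' tA A'E] := cube_vertex (f (fun t => t.1.1)) cA.
have [B' tB B'E] := cube_vertex (f (fun t => t.1.2)) cB.
have [C' tC C'E] := cube_vertex (f (fun t => t.2)) cC.
have /(types_le6 tA tB tC) : uniq (s ++ [:: t1; t2; t3]).
  rewrite cat_uniq us ut andbT; apply/hasPn => t /subt.
  by rewrite inE.
rewrite size_cat s4 => le7; suff: 7 <= 6 by [].
apply: le7 => t; rewrite mem_cat => /orP[/subs/imsetP[v /setDP[Yv Jv] ->]|].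
  apply/imsetP; exists v => //.
  by rewrite /vtype A'E B'E C'E (negbTE Jv).
have ne (u v : X) : u != v -> ((u == v) = false) * ((v == u) = false).
  by move=> /negbTE uv; rewrite [v == u]eq_sym uv.
have vt v : v \in J -> vtype A' B' C' v =
    if v == x then t1 else if v == y then t2 else t3.
  move=> Jv; rewrite /vtype A'E B'E C'E Jv /f.
  by do !case: ifP => _; rewrite -!surjective_pairing.
rewrite !inE => /or3P[] /eqP->; apply/imsetP; [exists x | exists y | exists z] => //;
  by rewrite vt ?inE ?eqxx ?orbT // !(ne _ _ xy, ne _ _ xz, ne _ _ yz).
Qed.

(** Edges of a 3-uniform hypergraph, read on ordered triples. Distinctness is built in, so that the
    six vertices of a K_{2,2,2} are distinct. *)
Definition cube3 Y a b c := [&& a != b, a != c, b != c & cubes Y [set a; b; c] != set0].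

Lemma cubes3_K222_free Y a1 a2 b1 b2 c1 c2 : 6 < #|Y| ->
  a1 \in Y -> a2 \in Y -> b1 \in Y -> b2 \in Y -> c1 \in Y -> c2 \in Y ->
  a1 != a2 -> b1 != b2 -> c1 != c2 ->
  (cube3 Y a1 b1 c1 && cube3 Y a2 b1 c1) && (cube3 Y a1 b2 c1 && cube3 Y a2 b2 c1) ->
  (cube3 Y a1 b1 c2 && cube3 Y a2 b1 c2) && (cube3 Y a1 b2 c2 && cube3 Y a2 b2 c2) -> False.
Proof.
move=> gt6 Ya1 Ya2 Yb1 Yb2 Yc1 Yc2 a12 b12 c12.
case/andP=> /andP[/and4P[a1b1 a1c1 b1c1 /set0Pn[W1 cW1]] /and4P[a2b1 a2c1 _ _]].
case/andP=> /and4P[a1b2 _ b2c1 _] /and4P[a2b2 _ _ _].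
case/andP=> /andP[/and4P[_ a1c2 b1c2 _] /and4P[_ a2c2 _ /set0Pn[W3 cW3]]].
case/andP=> /and4P[_ _ b2c2 /set0Pn[W2 cW2]] _.
have [p Yp] : exists2 p, p \in Y & p \notin [:: a1; a2; b1; b2; c1; c2].
  apply/exists_inP; apply: contraLR gt6 => /exists_inPn sub.
  rewrite -leqNgt (leq_trans _ (card_size [:: a1; a2; b1; b2; c1; c2])) //.
  by apply: subset_leq_card; apply/subsetP => v /sub; rewrite negbK.
rewrite !inE !negb_or => /and5P[pa1 pa2 pb1 pb2 /andP[pc1 pc2]].
(* Among the triples a1b1c1, a1b2c2, a2b1c2, each of a1, b1, c2 lies in two, each of a2, b2, c1 in
   one, and p in none: this gives the nine free bits. *)
have [x1 [x2 [x3 [y1 [y2 [y3 [z1 [z2 [z3 ]]]]]]]]] :=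
  distinct_types (p \in W1) (p \in W2) (p \in W3) (a1 \in W3) (a2 \in W1)
    (a2 \in W2) (b1 \in W2) (b2 \in W1) (b2 \in W3) (c1 \in W2) (c1 \in W3)
    (c2 \in W1).
pose f (u v : X) (x y z : bool) w := if w == u then x else if w == v then y else z.
have [E1 tE1 E1E] := cube_vertex (f a1 b1 x1 y1 z1) cW1.
have [E2 tE2 E2E] := cube_vertex (f a1 b2 x2 y2 z2) cW2.
have [E3 tE3 E3E] := cube_vertex (f a2 b1 x3 y3 z3) cW3.
have ne (u v : X) : u != v -> ((u == v) = false) * ((v == u) = false).
  by move=> /negbTE uv; rewrite [v == u]eq_sym uv.
have neq := (ne _ _ a12, ne _ _ b12, ne _ _ c12, ne _ _ a1b1, ne _ _ a1b2,
  ne _ _ a1c1, ne _ _ a1c2, ne _ _ a2b1, ne _ _ a2b2, ne _ _ a2c1, ne _ _ a2c2,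
  ne _ _ b1c1, ne _ _ b1c2, ne _ _ b2c1, ne _ _ b2c2, ne _ _ pa1, ne _ _ pa2,
  ne _ _ pb1, ne _ _ pb2, ne _ _ pc1, ne _ _ pc2).
have sub : [seq vtype E1 E2 E3 v | v <- [:: a1; b1; c2; p; a2; b2; c1]] =
  [:: (x1, x2, a1 \in W3); (y1, b1 \in W2, y3); (c2 \in W1, z2, z3);
      (p \in W1, p \in W2, p \in W3); (a2 \in W1, a2 \in W2, x3);
      (b2 \in W1, y2, b2 \in W3); (z1, c1 \in W2, c1 \in W3)].
  by rewrite /= /vtype !E1E !E2E !E3E !inE /f !(eqxx, neq).
rewrite -sub => /(types_le6 tE1 tE2 tE3) le7.
suff: 7 <= 6 by [].
apply: le7 => _ /mapP[v + ->]; rewrite !inE => Yv; apply: imset_f.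
by case/or4P: Yv => [|||/or4P[]] /eqP->.
Qed.

End Cubes.

(** * Weighted cube counts and their recursion *)

Section Counting.
Variables (X : finType) (F : {set {set X}}).
Implicit Types (Y J : {set X}).

(* A sum over ordered tuples: each set of [d] points is counted d! times. *)
Fixpoint cube_count d Y J :=
  if d is d'.+1 then \sum_(x in Y :\: J) cube_count d' Y (x |: J)
  else #|cubes F Y J|.

(** [cubes_rec] is summed over tuples and over the new point [k]: a d-tuple outside [J] leaves #|Y
    :\: J| - d choices of [k], whence the factor. *)
Lemma cube_count_rec d Y J : J \subset Y ->
  (#|Y :\: J| - d) * cube_count d Y J
    <= cube_count d.+1 Y J + \sum_(k in Y :\: J) cube_count d (Y :\ k) J.
Proof.
elim: d J => [|d IHd] J sJY.
  rewrite subn0 -sum_nat_const -big_split; apply: leq_sum => k /setDP[Yk Jk].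
  exact: cubes_rec.
(* Double counting of the pairs of distinct points (x, k), where [x] extends the tuple and [k] is
   deleted. *)
have -> : \sum_(k in Y :\: J) cube_count d.+1 (Y :\ k) J =
    \sum_(x in Y :\: J) \sum_(k in Y :\: (x |: J)) cube_count d (Y :\ k) (x |: J).
  rewrite [RHS](exchange_big_dep [in Y :\: J]) /=.
    apply: eq_bigr => k /setDP[Yk Jk]; apply: eq_bigl => x.
    by rewrite !inE Yk (negbTE Jk) orbF andbT eq_sym -andbA [(x \in Y) && _]andbC.
  by move=> x k _; rewrite !inE => /andP[]; rewrite negb_or => /andP[_ ->] ->.
rewrite [cube_count d.+2 _ _]/= -big_split /= big_distrr /=.
apply: leq_sum => x Jx; have /setDP[Yx nJx] := Jx.
have -> : #|Y :\: J| - d.+1 = #|Y :\: (x |: J)| - d.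
  by rewrite setUC -setDDl (cardsD1 x (Y :\: J)) Jx.
by apply: IHd; rewrite subUset sub1set Yx.
Qed.

Hypothesis le6 : forall A B C, A \in F -> B \in F -> C \in F ->
  #|vtype A B C @: setT| <= 6.

Lemma cube_count3_le Y :
  exists2 S, S ^ 4 <= 6 * #|Y| ^ 11 & cube_count 3 Y set0 <= 8 * S.
Proof.
exists (\sum_(a in Y) \sum_(b in Y) \sum_(c in Y) cube3 F Y a b c).
  (* With at most 6 points there is no seventh point to exclude a K_{2,2,2}; the trivial bound
     #|Y|^12 <= 6 * #|Y|^11 takes over, whence the constant 6. *)
  have [le6Y|gt6] := leqP #|Y| 6; last first.
    apply: leq_trans (K222_free_bound _) _; last by rewrite leq_mul2r orbT.
    by move=> a1 a2 b1 b2 c1 c2; exact: (@cubes3_K222_free _ _ le6).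
  apply: (@leq_trans ((#|Y| ^ 3) ^ 4)).
    rewrite leq_exp2r //.
    apply: (@leq_trans (\sum_(a in Y) \sum_(b in Y) \sum_(c in Y) 1)).
      by do 3![apply: leq_sum => ? _]; exact: leq_b1.
    by rewrite !sum_nat_const muln1 !expnS expn0 muln1.
  by rewrite -expnM expnS leq_mul2r le6Y orbT.
have sum_sub (A : {set X}) (f g : X -> nat) : A \subset Y ->
    (forall v, v \in A -> f v <= 8 * g v) ->
    \sum_(v in A) f v <= 8 * \sum_(v in Y) g v.
  move=> sAY le_fg; apply: (@leq_trans (\sum_(v in A) 8 * g v)); first exact: leq_sum.
  rewrite -big_distrr leq_mul2l /= (bigID [in A] [in Y]) /=.
  rewrite [X in _ <= X + _](eq_bigl [in A]) ?leq_addr // => v; apply: andb_idl.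
  exact: (subsetP sAY).
apply: (sum_sub) => [|a]; first exact: subsetDl.
rewrite setU0 => /setDP[Ya _].
apply: (sum_sub) => [|b /setDP[Yb]]; first exact: subsetDl.
rewrite inE => ab; apply: (sum_sub) => [|c /setDP[Yc]]; first exact: subsetDl.
rewrite !inE negb_or => /andP[cb ca].
rewrite setUA -setUA [[set c] :|: _]setUC.
rewrite [[set b] :|: _]setUC /cube3 eq_sym ab eq_sym ca eq_sym cb /=.
have [->|_] := eqVneq (cubes _ _ _) set0; first by rewrite cards0.
by apply: (card_cubes3_le8 le6); rewrite // eq_sym.
Qed.

End Counting.

(** * Growth of the 3/4 power *)

Import Order.TTheory GRing.Theory Num.Theory.
Local Open Scope ring_scope.

(** With q and r fourth roots of consecutive numbers, this is the discrete form of the derivative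
    (3/4) x^(-1/4) of x^(3/4). *)
Lemma cube_increment (R : realFieldType) (q r : R) :
  0 <= q -> 0 <= r -> q ^+ 4 = r ^+ 4 + 1 -> 3 <= 4 * (q * (q ^+ 3 - r ^+ 3)).
Proof.
move=> q0 r0 qr.
have : 0 <= (q - r) ^+ 2 * (q ^+ 2 + 2 * (q * r) + 3 * r ^+ 2).
  by rewrite mulr_ge0 ?sqr_ge0 // !addr_ge0 ?mulr_ge0 ?sqr_ge0.
have -> : (q - r) ^+ 2 * (q ^+ 2 + 2 * (q * r) + 3 * r ^+ 2)
  = 4 * (q * (q ^+ 3 - r ^+ 3)) - 3 * (q ^+ 4 - r ^+ 4) by ring.
by rewrite qr; lra.
Qed.

(** * Telescoping from dimension 3 down to dimension 0 *)

Section Averaging.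
(** [q n] is the fourth root of [n], specified algebraically so that all estimates stay
    polynomial. *)
Variables (R : realFieldType) (q : nat -> R).
Hypotheses (q_ge0 : forall n, 0 <= q n) (q4 : forall n, q n ^+ 4 = n%:R).
Variables (X : finType) (F : {set {set X}}).
Hypothesis le6 : forall A B C, A \in F -> B \in F -> C \in F ->
  (#|vtype A B C @: setT| <= 6)%N.

Let N d Y : R := (cube_count F d Y set0)%:R.

Lemma root4_le m n : (m <= n)%N -> q m <= q n.
Proof. by move=> le_mn; rewrite -(@ler_pXn2r _ 4) ?nnegrE // !q4 ler_nat. Qed.

(** A uniform bound [b] for the sets [Y :\ k] replaces the average. Divided by (n+1)n...(n+1-d), the
    inequality says that the count for [d], normalized by the falling factorial of #|Y|, grows by at
    most the normalized count for d + 1. *)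
Lemma cube_count_step d n (Y : {set X}) (b : R) : #|Y| = n.+1 -> (d <= n)%N ->
  (forall k, k \in Y -> N d (Y :\ k) <= b) ->
  (n.+1%:R - d%:R) * N d Y <= N d.+1 Y + n.+1%:R * b.
Proof.
move=> cY dn leb; have := cube_count_rec F d (sub0set Y).
rewrite setD0 cY -(ler_nat R) natrM natrD natrB ?(leqW dn) // => /le_trans; apply.
rewrite lerD2l natr_sum; apply: le_trans (ler_sum _ leb) _.
by rewrite sumr_const cY mulr_natl.
Qed.

(** The bound 16 q^11 is rewritten as an increment of q^3, ready to telescope. The constant is 96 =
    16 * (4/3) * (9/2). *)
Lemma cube_count3_bound n (Y : {set X}) : #|Y| = n.+1 -> (2 <= n)%N ->
  N 3 Y <= 96 * (n.+1%:R * n%:R * (n%:R - 1)) * (q n.+1 ^+ 3 - q n ^+ 3).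
Proof.
move=> cY n2; have [S S4 NS] := cube_count3_le le6 Y.
have qS := q4 n.+1; have M : q n.+1 ^+ 4 = n%:R + 1 by rewrite qS -natr1.
have leS : S%:R <= 2 * q n.+1 ^+ 11.
  rewrite -(@ler_pXn2r _ 4) ?nnegrE ?ler0n ?mulr_ge0 ?exprn_ge0 //.
  have -> : (2 * q n.+1 ^+ 11) ^+ 4 = 16 * (q n.+1 ^+ 4) ^+ 11 by ring.
  rewrite qS -!natrX -!natrM ler_nat; apply: leq_trans S4 _.
  by rewrite cY leq_mul2r orbT.
have {}NS : N 3 Y <= 16 * q n.+1 ^+ 11.
  have : N 3 Y <= (8 * S)%:R by rewrite ler_nat.
  by rewrite natrM; lra.
have n2R : 2 <= n%:R :> R by rewrite ler_nat.
have := cube_increment (q_ge0 n.+1) (q_ge0 n) (etrans M (congr1 (+%R^~ 1) (esym (q4 n)))).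
have : 0 <= q n.+1 ^+ 3 - q n ^+ 3 by rewrite subr_ge0 lerXn2r ?nnegrE ?root4_le.
have : 0 <= q n.+1 ^+ 11 by rewrite exprn_ge0.
set D := _ - _ => q11 D0 inc.
have : q n.+1 ^+ 11 * 3 <= q n.+1 ^+ 11 * (4 * (q n.+1 * D)) by rewrite ler_wpM2l.
have -> : q n.+1 ^+ 11 * (4 * (q n.+1 * D)) = 4 * (q n.+1 ^+ 4) ^+ 3 * D by ring.
rewrite qS => le3.
have : 2 * (n.+1%:R ^+ 3 * D) <= 9 * (n.+1%:R * n%:R * (n%:R - 1)) * D.
  rewrite mulrA ler_wpM2r // -natr1; nra.
lra.
Qed.

(** Serves the base cases of the inductions below. *)
Lemma cube_count_crude d (Y J : {set X}) :
  (cube_count F d Y J <= #|Y| ^ d * 2 ^ #|Y|)%N.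
Proof.
elim: d J => [|d IHd] J /=.
  rewrite mul1n -card_powerset; apply: subset_leq_card; apply/subsetP => W.
  by case/cubesP => sW _; rewrite inE (subset_trans sW) ?subsetDl.
apply: (@leq_trans (\sum_(x in Y :\: J) #|Y| ^ d * 2 ^ #|Y|)); first exact: leq_sum.
by rewrite sum_nat_const expnS -mulnA leq_mul2r subset_leq_card ?subsetDl ?orbT.
Qed.

Lemma root4_ge1 n : 1 <= q n.+1.
Proof.
by rewrite -(@ler_pXn2r _ 4) ?nnegrE ?ler01 // q4 expr1n ler1n.
Qed.

Lemma natr_cube_count_crude d (Y : {set X}) : N d Y <= (#|Y| ^ d * 2 ^ #|Y|)%:R.
Proof. by rewrite ler_nat cube_count_crude. Qed.

Lemma cardsD1_succ n (Y : {set X}) k : #|Y| = n.+1 -> k \in Y -> #|Y :\ k| = n.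
Proof. by move=> cY Yk; move: cY; rewrite (cardsD1 k) Yk => -[]. Qed.

(** Normalized by #|Y| (#|Y| - 1), the increments 96 (q_{k+1}^3 - q_k^3) telescope exactly. *)
Lemma cube_count2_bound n (Y : {set X}) : #|Y| = n.+2 ->
  N 2 Y <= 96 * (n.+2%:R * n.+1%:R) * q n.+2 ^+ 3.
Proof.
elim: n Y => [|n IHn] Y cY.
  have := natr_cube_count_crude 2 Y; rewrite cY.
  by have := exprn_ege1 3 (root4_ge1 1); lra.
have := cube_count_step cY (isT : 2 <= n.+2)%N
  (fun k Yk => IHn (Y :\ k) (cardsD1_succ cY Yk)).
have := cube_count3_bound cY isT.
have n0 : 0 <= n%:R :> R by rewrite ler0n.
rewrite -[n.+3%:R]natr1 -[n.+2%:R]natr1 -[n.+1%:R]natr1.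
set M := n%:R in n0 *; set D := q n.+3 ^+ 3; set E := q n.+2 ^+ 3 => N3 N2.
have M1 : 0 < M + 1 by lra.
by rewrite -(ler_pM2l M1); lra.
Qed.

(** The normalized count N 1 Y / #|Y| grows by at most 96 q^3 per point, and [q] is monotone. *)
Lemma cube_count1_bound n (Y : {set X}) : #|Y| = n.+1 ->
  N 1 Y <= 96 * n.+1%:R ^+ 2 * q n.+1 ^+ 3.
Proof.
elim: n Y => [|n IHn] Y cY.
  have := natr_cube_count_crude 1 Y; rewrite cY.
  by have := exprn_ege1 3 (root4_ge1 0); lra.
have := cube_count_step cY (isT : 1 <= n.+1)%N
  (fun k Yk => IHn (Y :\ k) (cardsD1_succ cY Yk)).
have := cube_count2_bound cY.
have n0 : 0 <= n%:R :> R by rewrite ler0n.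
have : q n.+1 ^+ 3 <= q n.+2 ^+ 3 by rewrite lerXn2r ?nnegrE ?root4_le.
rewrite -[n.+2%:R]natr1 -[n.+1%:R]natr1.
set M := n%:R in n0 *; set D := q n.+2 ^+ 3; set E := q n.+1 ^+ 3 => ED N2 N1.
have M1 : 0 < M + 1 by lra.
rewrite -(ler_pM2l M1).
have : (M + 1 + 1) * (M + 1) ^+ 2 * E <= (M + 1 + 1) * (M + 1) ^+ 2 * D.
  by rewrite ler_wpM2l // mulr_ge0 ?exprn_ge0 //; lra.
by lra.
Qed.

(** Each point adds at most 96 n q^3; the final 1 is the trace on the empty set. *)
Lemma cube_count0_bound n (Y : {set X}) : #|Y| = n ->
  N 0 Y <= 96 * n%:R ^+ 2 * q n ^+ 3 + 1.
Proof.
elim: n Y => [|n IHn] Y cY.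
  by have := natr_cube_count_crude 0 Y; rewrite cY; lra.
have := cube_count_step cY (leq0n n)
  (fun k Yk => IHn (Y :\ k) (cardsD1_succ cY Yk)).
have := cube_count1_bound cY.
have n0 : 0 <= n%:R :> R by rewrite ler0n.
have : q n ^+ 3 <= q n.+1 ^+ 3 by rewrite lerXn2r ?nnegrE ?root4_le.
have : 0 <= q n.+1 ^+ 3 by rewrite exprn_ge0.
rewrite -[n.+1%:R]natr1.
set M := n%:R in n0 *; set D := q n.+1 ^+ 3; set E := q n ^+ 3 => D0 ED N1 N0.
have M1 : 0 < M + 1 by lra.
rewrite -(ler_pM2l M1).
have : (M + 1) * M ^+ 2 * E <= (M + 1) * M ^+ 2 * D.
  by rewrite ler_wpM2l // mulr_ge0 ?exprn_ge0 //; lra.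
have : 0 <= (M + 1) * (M * D) by rewrite !mulr_ge0 // ltW.
by lra.
Qed.
End Averaging.

(** * From the counting bound to seven Venn regions *)

Lemma card_vtype_le_regions (X : finType) (A : 'I_3 -> {set X}) :
  (#|vtype (A (inord 0)) (A (inord 1)) (A (inord 2)) @: setT|
     <= #|nonempty_regions A|)%N.
Proof.
pose bits (S : {set 'I_3}) : bool * bool * bool :=
  (inord 0 \in S, inord 1 \in S, inord 2 \in S).
apply: leq_trans (leq_imset_card bits _).
apply: subset_leq_card; apply/subsetP => _ /imsetP[v _ ->].
apply/imsetP; exists [set i | v \in A i]; last by rewrite /bits !inE.
by rewrite inE; apply/existsP; exists v; apply/forallP => i; rewrite inE.
Qed.

Lemma card_le_cubes0 (X : finType) (F : {set {set X}}) :
  (#|F| <= #|cubes F setT set0|)%N.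
Proof.
apply: subset_leq_card; apply/subsetP => W FW; apply/cubesP.
split=> [|S]; first by rewrite setD0 subsetT.
by rewrite subset0 => /eqP->; rewrite setU0; apply/imsetP; exists W; rewrite // setIT.
Qed.

Lemma seven_regions_of_large (R : realFieldType) (q : nat -> R) (X : finType)
    (F : {set {set X}}) :
  (forall n, 0 <= q n) -> (forall n, q n ^+ 4 = n%:R) -> (0 < #|X|)%N ->
  97 * (#|X|%:R ^+ 2 * q #|X| ^+ 3) < #|F|%:R ->
  exists A : 'I_3 -> {set X},
    (forall i, A i \in F) /\ (7 <= #|nonempty_regions A|)%N.
Proof.
move=> q_ge0 q4 X0 gtF.
have [/existsP[A /andP[/forallP FA gt6]]|no7] :=
    boolP [exists A : {ffun 'I_3 -> {set X}},
      [forall i, A i \in F] && (7 <= #|nonempty_regions A|)%N].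
  by exists A.
have le6 A B C : A \in F -> B \in F -> C \in F -> (#|vtype A B C @: setT| <= 6)%N.
  move=> FA FB FC; rewrite leqNgt; apply: contra no7 => gt6.
  (* The default [A] of [nth] is never reached, as indices are below 3. *)
  apply/existsP; exists [ffun i : 'I_3 => nth A [:: A; B; C] i]; apply/andP; split.
    by apply/forallP => -[[|[|[|]]]] //= ?; rewrite ffunE.
  apply: leq_trans gt6 _.
  have := card_vtype_le_regions [ffun i : 'I_3 => nth A [:: A; B; C] i].
  by rewrite !ffunE !inordK.
have := cube_count0_bound q_ge0 q4 le6 (cardsT X).
have : #|F|%:R <= #|cubes F setT set0|%:R :> R by rewrite ler_nat card_le_cubes0.
(* This absorbs the additive 1 of [cube_count0_bound], turning 96 into 97. *)
have : 1 <= #|X|%:R ^+ 2 * q #|X| ^+ 3.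
  case: #|X| X0 => // n _.
  by rewrite mulr_ege1 ?exprn_ege1 ?ler1n ?(root4_ge1 q_ge0 q4).
by move: gtF; rewrite /=; lra.
Qed.

(* Real powers as fourth roots *)
From mathcomp Require Import all_classical all_reals all_analysis.

Theorem theorem3p2 (R : realType) :
  exists c : R, 0 < c /\
    forall (n : nat) (X : finType) (F : {set {set X}}),
      (0 < n)%N -> #|X| = n ->
      c * n%:R `^ (3 - 1 / 4) < #|F|%:R ->
      exists A : 'I_3 -> {set X},
        (forall i, A i \in F) /\ (7 <= #|nonempty_regions A|)%N.
Proof.
exists 97; split=> // n X F n0 cX; rewrite -cX in n0 *; move=> gtF.
have q4 k : (k%:R `^ (1 / 4) : R) ^+ 4 = k%:R.
  by rewrite -powR_mulrn ?powR_ge0 // -powRrM divfK ?powRr1 ?pnatr_eq0.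
have q_ge0 k : 0 <= (k%:R `^ (1 / 4) : R) by exact: powR_ge0.
apply: (seven_regions_of_large q_ge0 q4) => //.
(* The exponents agree: 2 + 3/4 = 3 - 1/4. *)
have -> : #|X|%:R ^+ 2 * (#|X|%:R `^ (1 / 4)) ^+ 3 = #|X|%:R `^ (3 - 1 / 4) :> R.
  rewrite -!powR_mulrn ?powR_ge0 // -powRrM -powRD.
    by congr (_ `^ _); field.
  by rewrite pnatr_eq0 -lt0n; apply/implyP.
by [].
Qed.
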